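(* Let $p$ be an odd prime, $\Gamma\subseteq\mathbb{F}_p^*$ a multiplicative subgroup, and $f:\mathbb{F}_p\to\mathbb{R}$ a $\Gamma$-invariant real function, not identically zero, with $\sum_x f(x)=0$. Then for every integer $k\ge2$ either $$\mathsf{E}^{+}_{2^{k+1}} (f) \le 32 C^{1/4}_* \left(1+\log \frac{\| f\|_1}{\|f\|_2}\right) \| f\|^{2^{k+1}}_2\, \mathsf{E}^{+}_{2^k} (f)\, |\Gamma|^{-1/8}$$ or $$\mathsf{E}^{+}_{2^{k+1}} (f) \le 2 \| f\|^{2^{k+2}}_2.$$ In particular, if $k$ satisfies $$|\Gamma|^{\frac{k-1}{8}} \ge \left(32 C^{1/4}_* \left(1+\log \frac{\| f\|_1}{\|f\|_2}\right)\right)^{k-1} \|f\|_1^2 \|f\|^{-2}_2,$$ then $\mathsf{E}^{+}_{2^{k+1}} (f) \le 2 \| f\|^{2^{k+2}}_2$. Here $C_*\ge1$ is an absolute constant (a constant such that for all $A,Q\subseteq\mathbb{F}_p$, $A,Q\neq\{0\}$, and real $M\ge1$ with $|QA|\le M|Q|$, one has $\mathsf{E}^+(Q)\le C_*\left(\frac{M^2|Q|^4}{p}+\frac{M^{3/2}|Q|^3}{|A|^{1/2}}\right)$).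
   Context: $f$ is $\Gamma$-invariant if $f(x\gamma)=f(x)$ for all $x,\gamma\in\Gamma$. For real $f$, $(f\circ f)(x)=\sum_y f(y)f(y+x)$ and $\mathsf{E}^+_k(f)=\sum_{x\in\mathbb{F}_p}(f\circ f)(x)^k$. $\|f\|_1=\sum_x|f(x)|$, $\|f\|_2=(\sum_x|f(x)|^2)^{1/2}$. $QA=\{qa\}$; $\mathsf{E}^+(Q)$ is the number of $(q_1,\dots,q_4)\in Q^4$ with $q_1+q_2=q_3+q_4$. Logarithms are to base $2$. *)

(* Defs.v *)
From HB Require Import structures.
From mathcomp Require Import all_boot all_order all_algebra fingroup.
From mathcomp Require Import reals exp.

Set Implicit Arguments.
Unset Strict Implicit.
Unset Printing Implicit Defensive.

Import Order.TTheory GRing.Theory Num.Theory.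
Local Open Scope ring_scope.

Section FunctionsOnFp.
Variables (R : realType) (p : nat).
Implicit Types (f : 'F_p -> R) (G : {group {unit 'F_p}}).

Definition invariant_fun G f : Prop :=
  forall (x : 'F_p) (g : {unit 'F_p}), g \in G -> f (x * val g) = f x.

Definition corr f (x : 'F_p) : R := \sum_(y : 'F_p) f y * f (y + x).

Definition energy (k : nat) f : R := \sum_(x : 'F_p) corr f x ^+ k.

Definition l1norm f : R := \sum_(x : 'F_p) `|f x|.

Definition l2norm f : R := Num.sqrt (\sum_(x : 'F_p) `|f x| ^+ 2).

End FunctionsOnFp.

Definition log2 (R : realType) (x : R) : R := ln x / ln 2.

Definition prodset (p : nat) (Q A : {set 'F_p}) : {set 'F_p} :=
  [set q * a | q in Q, a in A].

Definition set_energy (p : nat) (Q : {set 'F_p}) : nat :=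
  #|[set t : ('F_p * 'F_p) * ('F_p * 'F_p) |
      [&& t.1.1 \in Q, t.1.2 \in Q, t.2.1 \in Q, t.2.2 \in Q &
          t.1.1 + t.1.2 == t.2.1 + t.2.2]]|.

(* The admissible values of C_*. The prime is quantified inside, so that C is *)
(* absolute. A must be nonempty for the division by |A|^(1/2) to make sense:  *)
(* with the convention x / 0 = 0 no C would be admissible otherwise.          *)
Definition energy_constant (R : realType) (C : R) : Prop :=
  1 <= C /\
  forall p : nat, prime p -> odd p ->
  forall (A Q : {set 'F_p}) (M : R),
    A != set0 -> A != [set 0] -> Q != [set 0] -> 1 <= M ->
    #|prodset Q A|%:R <= M * #|Q|%:R ->
    (set_energy Q)%:R <=
      C * (M ^+ 2 * #|Q|%:R ^+ 4 / p%:R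
           + M `^ (3 / 2) * #|Q|%:R ^+ 3 / #|A|%:R `^ (1 / 2)).

(* Main.v *)
Require Import Defs.
From mathcomp Require Import all_boot all_order all_algebra fingroup.
From mathcomp Require Import reals exp.
From mathcomp Require Import zify ring lra.

Import Order.TTheory GRing.Theory Num.Theory.
Local Open Scope ring_scope.

(* Write r = corr f, N = r 0 = |f|_2^2, K = 2 ^ k, w = |G|^(-1/2).              *)
(* Let P be a set of nonzero points on which d <= |r|.  Two applications of     *)
(* Cauchy-Schwarz and Hoelder's inequality give                                 *)
(*   d^(2K) |P|^4 <= N^K E(P) energy K f.                                       *)
(* When P is G-invariant, the hypothesis on C with A = G, M = 1 bounds E(P) by  *)
(* C (|P|^4 / p + |P|^3 w).  Since f has mean zero, energy 2 f <= p N^2 / |G|,  *)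
(* so either |P| / p <= w, or d is so small that the trivial bound suffices.    *)
(* Thus each dyadic level set of (r / N)^K contributes O(C w N^K energy K f) to *)
(* energy (2K) f.  If energy (2K) f > 2 N^(2K), then the point 0 and the values *)
(* below the first O(1 + log2 (|f|_1 / |f|_2)) levels contribute at most 3/4 of *)
(* it.  As energy (2K) f <= N^K energy K f always holds, C w may be assumed     *)
(* small, which allows replacing it by its fourth root.  The second part        *)
(* iterates the first, starting from energy 4 f <= N^3 |f|_1^2.                 *)

(** The gain comes from multiplicative symmetry. The function [corr f] inherits the invariance of f,
    so its level sets P off 0 are unions of G-orbits, and such sets have small additive energy
    ([set_energy_invariant_le]). A set on which |[corr f]| is large must, however, have large
    additive energy ([level_set_energy_bound]). Comparing the two bounds |P| in [level_set_bound];
    mean zero enters through [card_energy2_le], which makes the term |P|^4 / p harmless unless d is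
    too small to matter. [energy_levels_le] sums over the levels, [energy_dichotomy] gives the
    alternative, and [energy_iteration] the consequence. *)

Section FiniteSums.
Variables (R : realDomainType) (I : finType).
Implicit Types (a b g h v : I -> R).

(** Lagrange's identity: twice the difference of the two sides is a weighted sum of squares. *)
Lemma weighted_Cauchy_Schwarz g a b : (forall i, 0 <= g i) ->
  (\sum_i g i * (a i * b i)) ^+ 2
    <= (\sum_i g i * a i ^+ 2) * (\sum_i g i * b i ^+ 2).
Proof.
move=> g_ge0.
set s := \sum_i _; set A := (X in _ <= X * _); set B := (X in _ <= _ * X).
have : 0 <= \sum_i \sum_j g i * g j * (a i * b j - a j * b i) ^+ 2.
  apply: sumr_ge0 => i _; apply: sumr_ge0 => j _.
  by rewrite mulr_ge0 ?sqr_ge0 // mulr_ge0 ?g_ge0.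
suff -> : \sum_i \sum_j g i * g j * (a i * b j - a j * b i) ^+ 2
          = A * B + B * A - (s * s) *+ 2 by lra.
rewrite /A /B /s !big_distrlr /= -sumrMnl -big_split -sumrB; apply: eq_bigr => i _.
rewrite -sumrMnl -big_split -sumrB; apply: eq_bigr => j _ /=; ring.
Qed.

Lemma Cauchy_Schwarz a b :
  (\sum_i a i * b i) ^+ 2 <= (\sum_i a i ^+ 2) * (\sum_i b i ^+ 2).
Proof.
have := @weighted_Cauchy_Schwarz (fun=> 1) a b (fun=> ler01).
by rewrite -!mulr_sumr !mul1r.
Qed.

Lemma weighted_power_mean g h j :
    (forall i, 0 <= g i) -> (forall i, 0 <= h i) ->
  (\sum_i g i * h i) ^+ (2 ^ j)
    <= (\sum_i g i) ^+ (2 ^ j - 1) * \sum_i g i * h i ^+ (2 ^ j).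
Proof.
move=> g0 h0; have G0 : 0 <= \sum_i g i by apply: sumr_ge0.
elim: j => [|j IH].
  by rewrite expn0 subnn expr0 mul1r expr1.
have -> : (2 ^ j.+1 - 1 = (2 ^ j - 1) * 2 + 1)%N.
  by rewrite expnS; have := expn_gt0 2 j; case: (2 ^ j)%N => // n _; lia.
rewrite expnSr exprM exprD expr1 exprM.
apply: (le_trans (y := ((\sum_i g i) ^+ (2 ^ j - 1)
                        * \sum_i g i * h i ^+ (2 ^ j)) ^+ 2)).
  apply: lerXn2r IH; rewrite nnegrE.
    by apply/exprn_ge0/sumr_ge0 => i _; rewrite mulr_ge0.
  by rewrite mulr_ge0 ?exprn_ge0 // sumr_ge0 // => i _; rewrite mulr_ge0 ?exprn_ge0.
rewrite exprMn -mulrA; apply: ler_wpM2l; first by rewrite !exprn_ge0.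
have := @weighted_Cauchy_Schwarz g (fun=> 1) (fun i => h i ^+ (2 ^ j)) g0.
under eq_bigr do rewrite mul1r.
under [X in _ <= X * _ -> _]eq_bigr do rewrite expr1n mulr1.
by under [X in _ <= _ * X -> _]eq_bigr do rewrite -exprM.
Qed.

(** [weighted_power_mean] at exponent 2^j, squared; one more Cauchy-Schwarz then separates g from
    the powers of h. *)
Lemma Hoelder_dyadic g h j :
    (forall i, 0 <= g i) -> (forall i, 0 <= h i) ->
  (\sum_i g i * h i) ^+ (2 ^ j.+1)
    <= (\sum_i g i) ^+ (2 ^ j.+1 - 2)
       * ((\sum_i g i ^+ 2) * \sum_i h i ^+ (2 ^ j.+1)).
Proof.
move=> g0 h0; have G0 : 0 <= \sum_i g i by apply: sumr_ge0.
have -> : (2 ^ j.+1 - 2 = (2 ^ j - 1) * 2)%N.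
  by rewrite mulnBl mul1n expnSr.
rewrite expnSr !exprM.
apply: (le_trans (y := ((\sum_i g i) ^+ (2 ^ j - 1)
                        * \sum_i g i * h i ^+ (2 ^ j)) ^+ 2)).
  apply: lerXn2r (weighted_power_mean _ _ _ g0 h0); rewrite nnegrE.
    by apply/exprn_ge0/sumr_ge0 => i _; rewrite mulr_ge0.
  by rewrite mulr_ge0 ?exprn_ge0 // sumr_ge0 // => i _; rewrite mulr_ge0 ?exprn_ge0.
rewrite exprMn; apply: ler_wpM2l; first by rewrite !exprn_ge0.
have := Cauchy_Schwarz g (fun i => h i ^+ (2 ^ j)).
by under [X in _ <= _ * X -> _]eq_bigr do rewrite -exprM.
Qed.

End FiniteSums.

Lemma sum_dyadic_levels (R : realFieldType) (I : finType) (A : {set I})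
    (v F : I -> R) (m : nat) :
  (forall i, v i <= 1) ->
  \sum_(i in A) F i
    = \sum_(i in A | v i <= 2 ^- m) F i
      + \sum_(j < m) \sum_(i in A | 2 ^- j.+1 < v i <= 2 ^- j) F i.
Proof.
move=> v_le1; elim: m => [|m IH].
  by rewrite big_ord0 addr0; apply: eq_bigl => i; rewrite expr0 invr1 v_le1 andbT.
rewrite IH big_ord_recr /= [RHS]addrCA addrC; congr (_ + _).
rewrite (bigID (fun i => v i <= 2 ^- m.+1)) /= addrC [RHS]addrC; congr (_ + _).
  by apply: eq_bigl => i; rewrite -andbA -ltNge [X in _ && X]andbC.
apply: eq_bigl => i; rewrite -andbA; congr (_ && _).
case: (leP (v i) (2 ^- m.+1)) => [h|]; rewrite ?andbF // andbT.
apply: le_trans h _; rewrite lef_pV2 ?posrE ?exprn_gt0 //.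
by rewrite ler_eXn2l ?ltr1n.
Qed.

(** * Correlations, their sums and their behaviour under dilations *)

Section Correlation.
Variables (R : realType) (p : nat).
Implicit Types (f h : 'F_p -> R) (x c : 'F_p) (P : {set 'F_p}).

Lemma corr0 f : corr f 0 = \sum_x f x ^+ 2.
Proof. by apply: eq_bigr => x _; rewrite addr0. Qed.

Lemma corr0_ge0 f : 0 <= corr f 0.
Proof. by rewrite corr0 sumr_ge0 // => x _; rewrite sqr_ge0. Qed.

Lemma l2norm_sqr f : l2norm f ^+ 2 = corr f 0.
Proof.
rewrite /l2norm; under eq_bigr do rewrite real_normK ?num_real //.
by rewrite -corr0 sqr_sqrtr ?corr0_ge0.
Qed.

Lemma norm_corr_le f x : `|corr f x| <= corr f 0.
Proof.
rewrite -ler_sqr ?nnegrE ?corr0_ge0 ?normr_ge0 // real_normK ?num_real //.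
apply: le_trans (Cauchy_Schwarz _ _ _ _) _.
by rewrite corr0 expr2 [X in _ <= _ * X](reindex_inj (addIr x)).
Qed.

Lemma sum_corr f : \sum_x corr f x = (\sum_x f x) ^+ 2.
Proof.
rewrite exchange_big expr2 big_distrl; apply: eq_bigr => y _ /=.
by rewrite -mulr_sumr [in RHS](reindex_inj (addrI y)).
Qed.

Lemma sum_norm_corr_le f : \sum_x `|corr f x| <= l1norm f ^+ 2.
Proof.
rewrite -sum_corr; apply: ler_sum => x _; apply: le_trans (ler_norm_sum _ _ _) _.
by apply: ler_sum => y _; rewrite normrM.
Qed.

Lemma sum_corr_mul f h :
  \sum_x corr f x * h x = \sum_a \sum_b f a * f b * h (b - a).
Proof.
under eq_bigr do rewrite mulr_suml.
rewrite exchange_big; apply: eq_bigr => a _ /=.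
rewrite [RHS](reindex_inj (addrI a)) /=; apply: eq_bigr => x _.
by rewrite addrAC subrr add0r.
Qed.

(** Expanding the square and translating s leaves only differences. With c = 1 this serves
    Cauchy-Schwarz; for general c it shows that the right side is nonnegative when h = f. *)
Lemma sum_sqr_shift h f c :
  \sum_s (\sum_a h a * f (s + c * a)) ^+ 2 = \sum_x corr h x * corr f (c * x).
Proof.
rewrite (sum_corr_mul h (fun x => corr f (c * x))).
under eq_bigr do rewrite expr2 big_distrlr.
rewrite exchange_big; apply: eq_bigr => a _ /=.
rewrite exchange_big; apply: eq_bigr => b _ /=.
rewrite mulr_sumr (reindex_inj (addIr (- (c * a)))) /=.
apply: eq_bigr => s _; rewrite addrNK mulrBr.
by rewrite (_ : s - c * a + c * b = s + (c * b - c * a)); ring.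
Qed.

(** Unfold [corr f] and apply Cauchy-Schwarz against f; the remaining factor is [sum_sqr_shift] with
    c = 1. *)
Lemma sqr_sum_corr_le h f :
  (\sum_x h x * corr f x) ^+ 2 <= corr f 0 * \sum_z corr h z * corr f z.
Proof.
have -> : \sum_x h x * corr f x = \sum_y f y * \sum_x h x * f (y + 1 * x).
  under eq_bigr do rewrite mulr_sumr.
  rewrite exchange_big; apply: eq_bigr => y _ /=; rewrite mulr_sumr.
  by apply: eq_bigr => x _; rewrite mul1r; ring.
apply: le_trans (Cauchy_Schwarz _ _ _ _) _.
rewrite -corr0 sum_sqr_shift.
by under eq_bigr do rewrite mul1r.
Qed.

Section Invariance.
Variables (G : {group {unit 'F_p}}) (f : 'F_p -> R).
Hypothesis f_inv : invariant_fun G f.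

Lemma corr_invariant : invariant_fun G (corr f).
Proof.
move=> x g gG; rewrite /corr (reindex_inj (mulIr (valP g))) /=.
by apply: eq_bigr => y _; rewrite -mulrDl !f_inv.
Qed.

(* The sum over all dilations c of sum_x corr f x * corr f (c * x) factors; its *)
(* terms are nonnegative, and the term of c is energy 2 f when c is in G.       *)
Lemma card_energy2_le : prime p -> \sum_x f x = 0 ->
  #|G|%:R * energy 2 f <= p%:R * corr f 0 ^+ 2.
Proof.
move=> p_pr f0.
pose T (c : 'F_p) := \sum_x corr f x * corr f (c * x).
have T_ge0 c : 0 <= T c.
  by rewrite /T -sum_sqr_shift sumr_ge0 // => s _; rewrite sqr_ge0.
have TG g : g \in G -> T (val g) = energy 2 f.
  by move=> gG; apply: eq_bigr => x _; rewrite (mulrC (val g)) corr_invariant.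
(* The point x = 0 contributes (p - 1) N^2, where N = [corr f 0]. For x nonzero, c * x runs over all
   nonzero points, so mean zero gives - N * [corr f x]; these add up to N^2. *)
have sumT : \sum_(c | c != 0) T c = p%:R * corr f 0 ^+ 2.
  have sum_n0 : \sum_(c | c != 0) corr f c = - corr f 0.
    have := sum_corr f; rewrite f0 expr0n /= (bigD1 0) //= => /eqP.
    by rewrite addrC addr_eq0 => /eqP.
  rewrite exchange_big (bigD1 0) //=.
  under eq_bigr do rewrite mulr0.
  have p1 : p.-1%:R = p%:R - 1 :> R by rewrite -subn1 natrB ?prime_gt0.
  rewrite sumr_const cardC1 card_Fp // -[X in X + _]mulr_natr p1.
  have -> : \sum_(x | x != 0) \sum_(c | c != 0) corr f x * corr f (c * x)
            = \sum_(x | x != 0) corr f x * - corr f 0.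
    apply: eq_bigr => x x0; rewrite -mulr_sumr -sum_n0; congr (_ * _).
    rewrite [RHS](reindex_inj (mulIf x0)); apply: eq_bigl => c.
    by rewrite mulf_eq0 (negPf x0) orbF.
  by rewrite -mulr_suml sum_n0; ring.
rewrite -sumT mulr_natl -sumr_const.
rewrite (eq_bigr (fun g => T (val g))) => [|g /TG ->//].
rewrite -(big_imset (h := val)) /=; last by move=> g h _ _; apply: val_inj.
rewrite [leRHS](bigID (mem [set val g | g in G])) /=.
apply: ler_wpDr; first by apply: sumr_ge0.
rewrite le_eqVlt; apply/orP; left; apply/eqP; apply: eq_bigl => c.
rewrite andbC; case: imsetP => //= -[g _ ->].
by rewrite -unitfE (valP g).
Qed.
End Invariance.

Lemma energy2_indicator P :
  energy 2 (fun x => (x \in P)%:R : R) = (set_energy P)%:R.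
Proof.
pose D := [set u : ('F_p * 'F_p) * 'F_p |
  [&& u.1.2 \in P, u.1.2 + u.1.1 \in P, u.2 \in P & u.2 + u.1.1 \in P]].
(* A common difference x of two pairs of P corresponds to the additive quadruple (y + x) + z = y +
   (z + x). *)
pose F (u : ('F_p * 'F_p) * 'F_p) :=
  ((u.1.2 + u.1.1, u.2), (u.1.2, u.2 + u.1.1)).
have F_inj : injective F.
  move=> [[x y] z] [[x' y'] z'] E.
  have e1 : y + x = y' + x' := congr1 (fun t => t.1.1) E.
  have e2 : z = z' := congr1 (fun t => t.1.2) E.
  have e3 : y = y' := congr1 (fun t => t.2.1) E.
  by rewrite e2 e3; rewrite e3 in e1; rewrite (addrI _ e1).
have -> : set_energy P = #|D|.
  rewrite -(card_imset (mem D) F_inj) /set_energy; apply: eq_card => t.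
  rewrite inE; apply/idP/imsetP => [|[[[x y] z]]].
    case: t => [[a b] [c d]] /= /and5P[aP bP cP dP /eqP e].
    have dE : b + (a - c) = d by rewrite addrCA addrA e addrAC subrr add0r.
    by exists ((a - c, c), b); rewrite /F /= ?inE /= dE addrC subrK // bP dP cP aP.
  rewrite inE /= => /and4P[yP yxP zP zxP] -> /=.
  by rewrite yP yxP zP zxP /=; apply/eqP; ring.
rewrite -sum1_card natr_sum big_mkcond /=.
rewrite /energy; under [LHS]eq_bigr do rewrite expr2 big_distrlr.
rewrite !pair_bigA /=; apply: eq_bigr => -[[x y] z] _; rewrite inE /=.
by do 4![case: (_ \in P); rewrite /= ?(mulr0, mul0r, mul1r) //].
Qed.

Lemma sum_corr_indicator P :
  \sum_x corr (fun y => (y \in P)%:R : R) x = #|P|%:R ^+ 2.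
Proof. by rewrite sum_corr -natr_sum -big_mkcond sum1_card. Qed.

End Correlation.

(** * Size of the sets where the correlation is large *)

Section LevelSets.
Variables (R : realType) (p : nat) (f : 'F_p -> R).
Implicit Types (P : {set 'F_p}) (d : R) (j m n : nat).

Local Notation N := (corr f 0).

Lemma normrX_pow2 (x : R) j : `|x| ^+ (2 ^ j.+1) = x ^+ (2 ^ j.+1).
Proof. by rewrite expnS !exprM real_normK ?num_real. Qed.

Lemma exprn_pow2_ge0 (x : R) j : 0 <= x ^+ (2 ^ j.+1).
Proof. by rewrite -normrX_pow2 exprn_ge0. Qed.

Lemma energy_pow2_ge0 j : 0 <= energy (2 ^ j.+1) f.
Proof. by apply: sumr_ge0 => x _; rewrite exprn_pow2_ge0. Qed.

Lemma level_set_energy_bound P d j : P != set0 -> 0 <= d ->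
    {in P, forall x, d <= `|corr f x|} ->
  d ^+ (2 ^ j.+2) * #|P|%:R ^+ 4
    <= N ^+ (2 ^ j.+1) * (set_energy P)%:R * energy (2 ^ j.+1) f.
Proof.
move=> Pn0 d0 dP; set K := (2 ^ j.+1)%N.
have K2 : (2 <= K)%N by rewrite /K expnS leq_pmulr ?expn_gt0.
have -> : (2 ^ j.+2 = 2 * K)%N by rewrite -expnS.
have P_gt0 : 0 < #|P|%:R :> R by rewrite ltr0n card_gt0.
pose b x : R := (x \in P)%:R.
(* The sign makes each point of P contribute at least d to the sum of h x * [corr f x], while
   |[corr h]| stays below [corr b]. *)
pose h x : R := b x * Num.sg (corr f x).
have corrh x : corr h x * corr f x <= corr b x * `|corr f x|.
  apply: le_trans (ler_norm _) _; rewrite normrM ler_wpM2r //.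
  apply: le_trans (ler_norm_sum _ _ _) _; apply: ler_sum => y _.
  have nh z : `|h z| <= b z.
    by rewrite /h normrM normr_nat ler_piMr ?ler0n // normr_sg lern1 leq_b1.
  by rewrite normrM ler_pM ?normr_ge0.
have b_ge0 z : 0 <= corr b z.
  by apply: sumr_ge0 => y _; rewrite mulr_ge0 ?ler0n.
set W := \sum_z corr b z * `|corr f z|.
have W_ge0 : 0 <= W by apply: sumr_ge0 => z _; rewrite mulr_ge0.
have dP_le : (d * #|P|%:R) ^+ 2 <= N * W.
  apply: (le_trans (y := (\sum_x h x * corr f x) ^+ 2)).
    have hE x : h x * corr f x = b x * `|corr f x|.
      by rewrite /h -mulrA -normrEsg.
    rewrite lerXn2r ?nnegrE ?mulr_ge0 ?sumr_ge0 //.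
      by move=> x _; rewrite hE mulr_ge0 ?ler0n.
    rewrite -sum1_card natr_sum mulr_sumr big_mkcond; apply: ler_sum => x _.
    by rewrite hE /b; case: ifP => [/dP|]; rewrite ?mulr1 ?mul1r ?mul0r.
  apply: le_trans (sqr_sum_corr_le _ _ _ _) _.
  by rewrite ler_wpM2l ?corr0_ge0 // ler_sum.
have W_le : W ^+ K <= (#|P|%:R ^+ 2) ^+ (K - 2)
                      * ((set_energy P)%:R * energy K f).
  rewrite -energy2_indicator -sum_corr_indicator /energy.
  under [X in _ <= _ * (_ * X)]eq_bigr do rewrite -normrX_pow2.
  exact: Hoelder_dyadic.
rewrite -(ler_pM2l (exprn_gt0 (2 * (K - 2)) P_gt0)).
apply: (le_trans (y := ((d * #|P|%:R) ^+ 2) ^+ K)).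
  rewrite -exprM exprMn mulrCA -exprD.
  by rewrite (_ : 2 * (K - 2) + 4 = 2 * K)%N //; lia.
apply: (le_trans (y := (N * W) ^+ K)).
  by rewrite lerXn2r ?nnegrE ?sqr_ge0 ?mulr_ge0 ?corr0_ge0.
rewrite exprMn -mulrA mulrCA ler_wpM2l ?exprn_ge0 ?corr0_ge0 //.
by rewrite exprM.
Qed.

Variables (C : R) (G : {group {unit 'F_p}}).
Hypotheses (hC : energy_constant C) (p_pr : prime p) (p_odd : odd p).
Hypotheses (f_inv : invariant_fun G f) (f_sum0 : \sum_x f x = 0).

Local Notation w := (#|G|%:R `^ (- (1 / 2)) : R).

Lemma cardG_pos : 0 < #|G|%:R :> R.
Proof. by rewrite ltr0n cardG_gt0. Qed.

Lemma inv_sqrt_cardG_sqr : w ^+ 2 = #|G|%:R^-1.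
Proof.
rewrite -powR_mulrn ?powR_ge0 // -powRrM -[RHS](powR_inv1 (ler0n _ _)).
by congr (_ `^ _); lra.
Qed.

Lemma inv_sqrt_cardG_le1 : w <= 1.
Proof.
rewrite -(ler_pXn2r (ltn0Sn 1)) ?nnegrE ?powR_ge0 // inv_sqrt_cardG_sqr expr1n.
by rewrite invf_le1 ?cardG_pos // ler1n cardG_gt0.
Qed.

Lemma set_energy_invariant_le P : 0 \notin P ->
    (forall x g, x \in P -> g \in G -> x * val g \in P) ->
  (set_energy P)%:R <= C * (#|P|%:R ^+ 4 / p%:R + #|P|%:R ^+ 3 * w).
Proof.
move=> P0 Pinv; pose A := [set val g | g in G].
have A1 : 1 \in A by apply/imsetP; exists 1%g.
have cardA : #|A| = #|G| by rewrite card_imset //; apply: val_inj.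
have QA : #|prodset P A|%:R <= 1 * #|P|%:R :> R.
  rewrite mul1r ler_nat; apply/subset_leq_card/subsetP => y.
  by case/imset2P=> x _ xP /imsetP[g gG ->] ->; apply: Pinv.
have [_ /(_ p p_pr p_odd A P 1)] := hC.
rewrite powR1 expr1n !mul1r cardA -powRN; apply => //.
- by apply/set0Pn; exists 1.
- by apply: contraTneq A1 => ->; rewrite inE oner_eq0.
- by apply: contraNneq P0 => ->; rewrite inE.
- by rewrite -[leRHS]mul1r.
Qed.

Lemma level_set_bound P d j : 0 \notin P ->
    (forall x g, x \in P -> g \in G -> x * val g \in P) ->
    0 < N -> 0 <= d -> {in P, forall x, d <= `|corr f x|} ->
  d ^+ (2 ^ j.+2) * #|P|%:R
    <= 2 * C * w * N ^+ (2 ^ j.+1) * energy (2 ^ j.+1) f.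
Proof.
move=> P0 Pinv N_gt0 d0 dP; set K := (2 ^ j.+1)%N.
have [C1 _] := hC; have C_ge0 : 0 <= C by lra.
have w_gt0 : 0 < w by rewrite powR_gt0 ?cardG_pos.
have w_ge0 := ltW w_gt0.
have E_ge0 := energy_pow2_ge0 j; rewrite -/K in E_ge0.
have NK_ge0 : 0 <= N ^+ K by rewrite exprn_ge0 ?ltW.
have [->|Pn0] := eqVneq P set0.
  by rewrite cards0 mulr0 !mulr_ge0 // ltW.
have P_gt0 : 0 < #|P|%:R :> R by rewrite ltr0n card_gt0.
have p_gt0 : 0 < p%:R :> R by rewrite ltr0n prime_gt0.
have card_le n : d ^+ (2 ^ n.+1) * #|P|%:R <= energy (2 ^ n.+1) f.
  rewrite -sum1_card natr_sum mulr_sumr big_mkcond; apply: ler_sum => x _.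
  case: ifP => [/dP dx|_]; last exact: exprn_pow2_ge0.
  by rewrite mulr1 -(normrX_pow2 (corr f x)) lerXn2r ?nnegrE.
(* For small d, split d^(2K) as d^K * d^K: one factor is at most N^K w, the other times |P| is at
   most [energy K f]. *)
have [d_small|d_large] := leP (d ^+ 2) (N ^+ 2 * w).
  have dK : d ^+ K <= N ^+ K * w.
    apply: (le_trans (y := (N ^+ 2 * w) ^+ (2 ^ j))).
      by rewrite /K expnS exprM lerXn2r ?nnegrE ?sqr_ge0 // mulr_ge0 ?sqr_ge0.
    rewrite exprMn -exprM -expnS ler_wpM2l // -[leRHS]expr1.
    by rewrite ler_wiXn2l ?inv_sqrt_cardG_le1 ?expn_gt0.
  have -> : (2 ^ j.+2 = K + K)%N by rewrite addnn -mul2n -expnS.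
  rewrite exprD -mulrA.
  apply: le_trans (ler_pM _ _ dK (card_le j)) _; rewrite ?exprn_ge0 //.
    by rewrite mulr_ge0 ?exprn_ge0 ?ler0n.
  have : 0 <= N ^+ K * w * energy K f by rewrite !mulr_ge0.
  by rewrite -/K; nra.
(* Here |P| N^2 w <= |P| d^2 <= [energy 2 f] <= p N^2 w^2. *)
have Pp : #|P|%:R / p%:R <= w.
  have N2w_gt0 : 0 < N ^+ 2 * w by rewrite mulr_gt0 ?exprn_gt0.
  rewrite ler_pdivrMr // -(ler_pM2r N2w_gt0) -(ler_pM2l cardG_pos).
  have -> : #|G|%:R * (w * p%:R * (N ^+ 2 * w)) = p%:R * N ^+ 2.
    rewrite (_ : _ * _ = #|G|%:R * w ^+ 2 * (p%:R * N ^+ 2)); last by ring.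
    by rewrite inv_sqrt_cardG_sqr mulfV ?mul1r // gt_eqF ?cardG_pos.
  apply: le_trans (card_energy2_le _ _ _ _ f_inv p_pr f_sum0).
  rewrite ler_wpM2l ?ler0n //; apply: le_trans (card_le 0%N).
  by rewrite expn1 mulrC ler_wpM2r ?ltW.
have := level_set_energy_bound P d j Pn0 d0 dP; rewrite -/K => bound.
have E_le : (set_energy P)%:R <= 2 * C * w * #|P|%:R ^+ 3.
  apply: le_trans (set_energy_invariant_le P P0 Pinv) _.
  have -> : 2 * C * w * #|P|%:R ^+ 3 = C * (#|P|%:R ^+ 3 * w + #|P|%:R ^+ 3 * w).
    by ring.
  rewrite ler_wpM2l // lerD2r exprSr -mulrA.
  by rewrite ler_wpM2l ?exprn_ge0 ?ler0n.
rewrite -(ler_pM2r (exprn_gt0 3 P_gt0)).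
rewrite [leLHS](_ : _ = d ^+ (2 ^ j.+2) * #|P|%:R ^+ 4); last by ring.
apply: le_trans bound _.
rewrite [leRHS](_ : _
  = N ^+ K * (2 * C * w * #|P|%:R ^+ 3) * energy K f); last by ring.
by rewrite ler_wpM2r // ler_wpM2l.
Qed.

End LevelSets.

(** The number m of dyadic levels: the least integer exceeding log2 (2 x^2). *)
Lemma log2_dyadic_scale (R : realType) (x : R) : 1 <= x ->
  exists m, 2 * x ^+ 2 <= 2 ^+ m /\ m%:R <= 2 * (1 + log2 x).
Proof.
move=> x1; have x_gt0 : 0 < x by lra.
have ln2 : 0 < ln 2 :> R by apply: ln_gt0; lra.
have log_ge0 : 0 <= log2 x by apply: divr_ge0; [exact: ln_ge0 | exact: ltW].
have y_ge0 : 0 <= 1 + 2 * log2 x by lra.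
exists (Num.truncn (1 + 2 * log2 x)).+1; split; last first.
  by have /andP[+ _] := truncn_itv y_ge0; rewrite -natr1; lra.
have x2_gt0 : 0 < 2 * x ^+ 2 by rewrite mulr_gt0 ?exprn_gt0.
have lt_m := truncnS_gt (1 + 2 * log2 x).
rewrite -ler_ln ?posrE ?exprn_gt0 // lnXn // lnM ?posrE ?exprn_gt0 // lnXn //.
rewrite -[_ *+ (Num.truncn _).+1]mulr_natl.
apply: le_trans (ler_wpM2r (ltW ln2) (ltW lt_m)).
by rewrite mulrDl mul1r -mulrA /log2 divfK ?gt_eqF // mulr_natl.
Qed.

(** * Summation over dyadic levels and iteration in k *)

Section EnergyIncrement.
Variables (R : realType) (p : nat) (f : 'F_p -> R).
Implicit Types (j m : nat).

Local Notation N := (corr f 0).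

Lemma corr0_gt0 : (exists x, f x <> 0) -> 0 < N.
Proof.
move=> [x /eqP fx]; rewrite corr0 (bigD1 x) //= ltr_pwDl //.
  by rewrite exprn_even_gt0.
by apply: sumr_ge0 => y _; rewrite sqr_ge0.
Qed.

Lemma corr_pow2_le x j : corr f x ^+ (2 ^ j.+1) <= N ^+ (2 ^ j.+1).
Proof. by rewrite -normrX_pow2 lerXn2r ?nnegrE ?corr0_ge0 ?norm_corr_le. Qed.

Lemma expr_pow2S (x : R) j :
  x ^+ (2 ^ j.+1) = x ^+ (2 ^ j) * x ^+ (2 ^ j).
Proof. by rewrite expnS mul2n -addnn exprD. Qed.

Lemma energy_pow2S_le j :
  energy (2 ^ j.+2) f <= N ^+ (2 ^ j.+1) * energy (2 ^ j.+1) f.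
Proof.
rewrite mulr_sumr; apply: ler_sum => x _; rewrite expr_pow2S.
by rewrite ler_wpM2r ?exprn_pow2_ge0 // corr_pow2_le.
Qed.

Lemma norm_corr_expr_le x n : `|corr f x| ^+ n.+1 <= N ^+ n * `|corr f x|.
Proof.
by rewrite exprSr ler_wpM2r // lerXn2r ?nnegrE ?corr0_ge0 ?norm_corr_le.
Qed.

(** With K = 2^(j+1), one factor [corr f x ^+ K] is at most 2^-m N^K, the other at most N^(K-1)
    |[corr f x]|, whose sum is controlled by the l1 norm. *)
Lemma sum_small_corr_le m j : 0 < N ->
  \sum_(x in [set~ 0] | corr f x ^+ (2 ^ j.+1) / N ^+ (2 ^ j.+1) <= 2 ^- m)
      corr f x ^+ (2 ^ j.+2)
    <= 2 ^- m * (N ^+ (2 ^ j.+2) * (l1norm f ^+ 2 / N)).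
Proof.
move=> N_gt0; set K := (2 ^ j.+1)%N.
have [n KE] : exists n, K = n.+1 by exists K.-1; rewrite prednK ?expn_gt0.
have c_ge0 : 0 <= 2 ^- m * (N ^+ K * N ^+ n).
  by rewrite mulr_ge0 ?invr_ge0 ?exprn_ge0 ?mulr_ge0 ?exprn_ge0 ?ltW.
have -> : 2 ^- m * (N ^+ (2 ^ j.+2) * (l1norm f ^+ 2 / N))
          = 2 ^- m * (N ^+ K * N ^+ n) * l1norm f ^+ 2.
  have NK : N ^+ K = N ^+ n * N by rewrite KE exprSr.
  rewrite expr_pow2S -/K {2}NK; field.
  by rewrite !gt_eqF ?exprn_gt0.
apply: le_trans (ler_wpM2l c_ge0 (sum_norm_corr_le _ _ f)).
rewrite mulr_sumr big_mkcond; apply: ler_sum => x _.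
case: ifP => [/andP[_]|_]; last by rewrite mulr_ge0.
rewrite ler_pdivrMr ?exprn_gt0 // => small.
rewrite expr_pow2S -/K mulrA -mulrA.
have rK : corr f x ^+ K <= N ^+ n * `|corr f x|.
  by rewrite -normrX_pow2 -/K KE norm_corr_expr_le.
rewrite [leRHS](_ : _ = (2 ^- m * N ^+ K) * (N ^+ n * `|corr f x|)); last by ring.
by rewrite ler_pM // exprn_pow2_ge0.
Qed.

Variables (C : R) (G : {group {unit 'F_p}}).
Hypotheses (hC : energy_constant C) (p_pr : prime p) (p_odd : odd p).
Hypotheses (f_inv : invariant_fun G f) (f_sum0 : \sum_x f x = 0).
Hypothesis f_neq0 : exists x, f x <> 0.

Local Notation w := (#|G|%:R `^ (- (1 / 2)) : R).

Lemma sum_level_corr_le m j :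
  \sum_(x in [set~ 0] | 2 ^- m.+1 < corr f x ^+ (2 ^ j.+1) / N ^+ (2 ^ j.+1)
                        <= 2 ^- m) corr f x ^+ (2 ^ j.+2)
    <= 8 * C * w * N ^+ (2 ^ j.+1) * energy (2 ^ j.+1) f.
Proof.
have N_gt0 := corr0_gt0 f_neq0; set K := (2 ^ j.+1)%N.
have NK_gt0 : 0 < N ^+ K by rewrite exprn_gt0.
pose P := [set x in [set~ 0] | 2 ^- m.+1 < corr f x ^+ K / N ^+ K <= 2 ^- m].
rewrite (eq_bigl (mem P)) => [|x]; last by rewrite [RHS]inE.
have P0 : 0 \notin P by rewrite !inE eqxx.
have Pinv x g : x \in P -> g \in G -> x * val g \in P.
  move=> + gG; rewrite !inE (corr_invariant _ _ _ _ f_inv) // => /andP[x0 ->].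
  by rewrite andbT mulf_neq0 // -unitfE (valP g).
(* For empty P the bound is used with d = 0, only to see that the right side is nonnegative.
   Otherwise d is the minimum of |[corr f]| on P. *)
have [P_eq0|/set0Pn[x0 x0P]] := eqVneq P set0.
  have := level_set_bound _ _ f _ _ hC p_pr p_odd f_inv f_sum0 P 0 j P0 Pinv N_gt0.
  rewrite P_eq0 big_set0 cards0 mulr0 => /(_ (lexx 0)).
  have h : {in set0, forall x, 0 <= `|corr f x|} by move=> x; rewrite inE.
  by move=> /(_ h); rewrite -/K; lra.
have [y yP ymin] := arg_minP (fun x => `|corr f x|) x0P.
have := level_set_bound _ _ f _ _ hC p_pr p_odd f_inv f_sum0 P _ j P0 Pinv N_gt0
         (normr_ge0 (corr f y)) ymin.
suff : \sum_(x in P) corr f x ^+ (2 ^ j.+2)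
        <= 4 * (`|corr f y| ^+ (2 ^ j.+2) * #|P|%:R) by rewrite -/K; lra.
rewrite -sum1_card natr_sum !mulr_sumr; apply: ler_sum => x xP.
have : x \in P := xP; rewrite inE => /andP[_ /andP[_ xup]]; rewrite mulr1.
(* Squaring this factor 2 loses 4, which together with the 2 of [level_set_bound] makes 8. *)
have : corr f x ^+ K <= 2 * corr f y ^+ K.
  have : y \in P := yP; rewrite inE => /andP[_ /andP[+ _]].
  move: xup; rewrite ler_pdivrMr // ltr_pdivlMr // exprS invfM.
  lra.
have := exprn_pow2_ge0 R (corr f x) j; have := exprn_pow2_ge0 R (corr f y) j.
rewrite normrX_pow2 !(expr_pow2S _ j.+1) -/K; nra.
Qed.

Lemma energy_levels_le m j :
  energy (2 ^ j.+2) f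
    <= N ^+ (2 ^ j.+2) + 2 ^- m * (N ^+ (2 ^ j.+2) * (l1norm f ^+ 2 / N))
       + m%:R * (8 * C * w * N ^+ (2 ^ j.+1) * energy (2 ^ j.+1) f).
Proof.
have N_gt0 := corr0_gt0 f_neq0.
rewrite {1}/energy (bigD1 0) //= -addrA lerD2l.
rewrite (eq_bigl (mem [set~ 0])) => [|x]; last by rewrite !inE.
rewrite (sum_dyadic_levels _ _ _
  (fun x => corr f x ^+ (2 ^ j.+1) / N ^+ (2 ^ j.+1)) _ m); last first.
  by move=> x; rewrite ler_pdivrMr ?exprn_gt0 // mul1r corr_pow2_le.
apply: lerD; first exact: sum_small_corr_le.
rewrite mulr_natl -[m in leRHS]card_ord -sumr_const.
by apply: ler_sum => i _; apply: sum_level_corr_le.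
Qed.

Local Notation rho := (l1norm f / l2norm f).

Lemma rho_sqr : rho ^+ 2 = l1norm f ^+ 2 / N.
Proof. by rewrite expr_div_n l2norm_sqr. Qed.

Lemma rho_ge1 : 1 <= rho.
Proof.
have l1_ge0 : 0 <= l1norm f by apply: sumr_ge0.
rewrite -(ler_pXn2r (ltn0Sn 1)) ?nnegrE ?divr_ge0 ?sqrtr_ge0 //.
rewrite expr1n rho_sqr ler_pdivlMr ?corr0_gt0 // mul1r.
apply: le_trans (sum_norm_corr_le _ _ f).
rewrite (bigD1 0) //= ger0_norm ?corr0_ge0 // lerDl.
by apply: sumr_ge0.
Qed.

Local Notation u := (C `^ (1 / 4) * #|G|%:R `^ (- (1 / 8))).

Lemma expr4_u : u ^+ 4 = C * w.
Proof.
have [C1 _] := hC.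
rewrite exprMn -!powR_mulrn ?powR_ge0 // -!powRrM.
have -> : 1 / 4 * 4%:R = 1 :> R by lra.
have -> : - (1 / 8) * 4%:R = - (1 / 2) :> R by lra.
by rewrite powRr1 //; lra.
Qed.

Lemma energy_dichotomy j :
  energy (2 ^ j.+2) f
    <= 32 * u * (1 + log2 rho) * N ^+ (2 ^ j.+1) * energy (2 ^ j.+1) f
  \/ energy (2 ^ j.+2) f <= 2 * N ^+ (2 ^ j.+2).
Proof.
have N_gt0 := corr0_gt0 f_neq0.
have [C1 _] := hC.
have u_gt0 : 0 < u.
  by rewrite mulr_gt0 ?powR_gt0 ?cardG_pos //; lra.
have L1 : 1 <= 1 + log2 rho.
  by rewrite lerDl divr_ge0 ?ln_ge0 ?rho_ge1 // ler1n.
set X := N ^+ (2 ^ j.+1) * energy (2 ^ j.+1) f.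
have X_ge0 : 0 <= X by rewrite mulr_ge0 ?energy_pow2_ge0 ?exprn_ge0 ?ltW.
have [small|large] := leP (energy (2 ^ j.+2) f) (2 * N ^+ (2 ^ j.+2)).
  by right.
left; rewrite -mulrA -/X.
(* If 32 u >= 1, the trivial bound [energy_pow2S_le] is already stronger than the claim. *)
have [u_large|u_small] := leP 1 (32 * u).
  apply: le_trans (energy_pow2S_le j) _; rewrite -/X.
  by rewrite ler_peMl // mulr_ege1.
have [m [m_ge m_le]] := log2_dyadic_scale _ _ rho_ge1.
have := energy_levels_le m j.
have -> : m%:R * (8 * C * w * N ^+ (2 ^ j.+1) * energy (2 ^ j.+1) f)
          = 8 * u ^+ 4 * (m%:R * X) by rewrite expr4_u /X; ring.
have half : 2 ^- m * (N ^+ (2 ^ j.+2) * (l1norm f ^+ 2 / N))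
            <= N ^+ (2 ^ j.+2) / 2.
  rewrite -rho_sqr mulrC -mulrA ler_wpM2l ?exprn_ge0 ?corr0_ge0 //.
  by rewrite ler_pdivrMr ?exprn_gt0 //; lra.
have mX : m%:R * X <= 2 * (1 + log2 rho) * X by rewrite ler_wpM2r.
have u4 : 64 * u ^+ 4 <= 32 * u.
  have -> : 64 * u ^+ 4 = 2 * u ^+ 3 * (32 * u) by ring.
  rewrite ler_piMl //; first by lra.
  have : u ^+ 3 <= u by rewrite -[leRHS]expr1 ler_wiXn2l //; lra.
  lra.
have LX_ge0 : 0 <= (1 + log2 rho) * X by rewrite mulr_ge0 //; lra.
have := ler_wpM2r LX_ge0 u4.
have := ler_wpM2l (exprn_ge0 4 (ltW u_gt0)) mX.
(* The point 0 and the small values give at most 3/2 N^(2K), less than 3/4 of the energy. So the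
   energy is at most 4 * 8 * 2 u^4 (1 + [log2 rho]) X, and 64 u^4 <= 32 u. *)
set t := u ^+ 4; set v := u; lra.
Qed.

Lemma energy4_le : energy (2 ^ 2) f <= rho ^+ 2 * N ^+ (2 ^ 2).
Proof.
have N_gt0 := corr0_gt0 f_neq0.
rewrite rho_sqr (_ : _ * _ = N ^+ 3 * l1norm f ^+ 2); last first.
  by rewrite (exprSr N 3); field; rewrite gt_eqF.
apply: le_trans (ler_wpM2l (exprn_ge0 3 (ltW N_gt0)) (sum_norm_corr_le _ _ f)).
rewrite mulr_sumr; apply: ler_sum => x _.
by rewrite -normrX_pow2 norm_corr_expr_le.
Qed.

Lemma energy_iteration j :
  energy (2 ^ j.+2) f <= 2 * N ^+ (2 ^ j.+2)
  \/ energy (2 ^ j.+2) f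
     <= (32 * u * (1 + log2 rho)) ^+ j * rho ^+ 2 * N ^+ (2 ^ j.+2).
Proof.
elim: j => [|j IH]; first by right; rewrite expr0 mul1r; apply: energy4_le.
have NK_ge0 : 0 <= N ^+ (2 ^ j.+2) by rewrite exprn_ge0 ?corr0_ge0.
have [step|] := energy_dichotomy j.+1; last by left.
(* The bound 2 N^(2K) passes to the next exponent by [energy_pow2S_le]; the other one gains a factor
   from the dichotomy. *)
case: IH => IH; [left | right].
  apply: le_trans (energy_pow2S_le j.+1) _.
  by rewrite (expr_pow2S _ j.+2) mulrCA ler_wpM2l.
apply: le_trans step _.
have q_ge0 : 0 <= 32 * u * (1 + log2 rho).
  rewrite mulr_ge0 ?mulr_ge0 ?powR_ge0 // addr_ge0 //.
  by apply: divr_ge0; apply: ln_ge0; [exact: rho_ge1 | lra].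
rewrite [leRHS](_ : _ = 32 * u * (1 + log2 rho) * N ^+ (2 ^ j.+2)
  * ((32 * u * (1 + log2 rho)) ^+ j * rho ^+ 2 * N ^+ (2 ^ j.+2))).
  by rewrite ler_wpM2l // mulr_ge0.
by rewrite (expr_pow2S _ j.+2) exprS; ring.
Qed.

End EnergyIncrement.

Theorem theorem27 (R : realType) (C : R) (hC : energy_constant C)
    (p : nat) (p_prime : prime p) (p_odd : odd p)
    (G : {group {unit 'F_p}}) (f : 'F_p -> R)
    (f_inv : invariant_fun G f)
    (f_neq0 : exists x : 'F_p, f x <> 0)
    (f_sum0 : \sum_(x : 'F_p) f x = 0)
    (k : nat) (k_ge2 : (2 <= k)%N) :
  (energy (2 ^ k.+1) f <=
     32 * C `^ (1 / 4) * (1 + log2 (l1norm f / l2norm f))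
       * l2norm f ^+ (2 ^ k.+1) * energy (2 ^ k) f * #|G|%:R `^ (- (1 / 8))
   \/ energy (2 ^ k.+1) f <= 2 * l2norm f ^+ (2 ^ k.+2))
  /\
  ((32 * C `^ (1 / 4) * (1 + log2 (l1norm f / l2norm f))) ^+ (k - 1)
       * l1norm f ^+ 2 * l2norm f ^- 2
     <= #|G|%:R `^ ((k%:R - 1) / 8) ->
   energy (2 ^ k.+1) f <= 2 * l2norm f ^+ (2 ^ k.+2)).
Proof.
case: k k_ge2 => // j _.
have l2X n : l2norm f ^+ (2 ^ n.+1) = corr f 0 ^+ (2 ^ n).
  by rewrite expnS exprM l2norm_sqr.
rewrite !l2X subn1 /=; split.
  have [le1|le2] := energy_dichotomy _ _ f _ _ hC p_prime p_odd f_inv f_sum0 f_neq0 j.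
    left; apply: le_trans le1 _.
    by rewrite le_eqVlt; apply/orP; left; apply/eqP; ring.
  by right.
move=> large.
have [//|le2] := energy_iteration _ _ f _ _ hC p_prime p_odd f_inv f_sum0 f_neq0 j.
apply: le_trans le2 _; rewrite ler_wpM2r ?exprn_ge0 ?corr0_ge0 //.
have g_gt0 : 0 < #|G|%:R `^ (1 / 8) :> R by rewrite powR_gt0 ?ltr0n ?cardG_gt0.
have gX : #|G|%:R `^ ((j.+1%:R - 1) / 8) = (#|G|%:R `^ (1 / 8)) ^+ j :> R.
  by rewrite -powR_mulrn ?powR_ge0 // -powRrM -natr1 addrK; congr (_ `^ _); lra.
(* After division by |G|^(j/8), the hypothesis says that the factor in front of N^(2K) in
   [energy_iteration] is at most 1. *)
rewrite gX in large; rewrite powRN expr_div_n.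
rewrite (_ : 32 * _ * _ = 32 * C `^ (1 / 4) * (1 + log2 (l1norm f / l2norm f))
  / #|G|%:R `^ (1 / 8)); last by ring.
rewrite expr_div_n mulrAC ler_pdivrMr ?exprn_gt0 // mulrA.
apply: le_trans large _; rewrite ler_peMl ?exprn_ge0 ?powR_ge0 //; lra.
Qed.
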